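(* For every integer $r\ge1$, $$\frac1{G^r}=1+\sum_{n=1}^{\infty}\frac1{3^n}\sum_{j=1}^{n}\binom{r+j-1}{j}\sum_{\substack{n_1+\cdots+n_j=n\\ n_i\ge1}}\ \prod_{\ell=1}^{j}\left[\sum_{k=1}^{n_\ell}\frac{(-1)^{k+1}2^k}{(2k+1)^2}\binom{n_\ell-1}{k-1}\right].$$ Every term (indexed by $n\ge1$) of the series following the initial term $1$ is a positive rational number.
   Context: $G=\sum_{k=0}^\infty\frac{(-1)^k}{(2k+1)^2}$ is Catalan's constant. The sum over $n_1+\cdots+n_j=n$, $n_i\ge1$, is over ordered $j$-tuples of positive integers with sum $n$. *)

(* Defs.v *)
From mathcomp Require Export all_boot all_order all_algebra.
From mathcomp Require Export classical_sets reals topology normedtype sequences.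
Export Order.TTheory GRing.Theory Num.Theory.
Export numFieldNormedType.Exports.

Set Implicit Arguments.
Unset Strict Implicit.
Unset Printing Implicit Defensive.

Local Open Scope classical_set_scope.
Local Open Scope ring_scope.

Definition catalan_constant (R : realType) : R :=
  limn (series (fun k : nat => (-1) ^+ k / (k.*2.+1)%:R ^+ 2 : R)).

Definition inner_sum (R : realType) (m : nat) : R :=
  \sum_(1 <= k < m.+1)
     (-1) ^+ k.+1 * 2 ^+ k / (k.*2.+1)%:R ^+ 2 * 'C(m.-1, k.-1)%:R.

(* Ordered j-tuples of positive integers with sum n: the parts are at most n,
   so letting them range over 'I_n.+1 loses nothing. *)
Definition compositions (n j : nat) : {set {ffun 'I_j -> 'I_n.+1}} :=
  [set p : {ffun 'I_j -> 'I_n.+1} |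
     [forall l, (1 <= p l)%N] && (\sum_(l < j) p l == n)%N].

Definition series_term (R : realType) (r n : nat) : R :=
  (3 ^+ n)^-1 *
  \sum_(1 <= j < n.+1)
     'C(r + j - 1, j)%:R *
     \sum_(p in compositions n j) \prod_(l < j) inner_sum R (p l).

(* Main.v *)
Require Import Defs.
From mathcomp Require Import boolp derive.
From mathcomp Require Import ring lra.

(** Write a_m for the inner sum and g_k = (-1)^k / (2k+1)^2 for the terms of
    Catalan's constant G.  Three facts combine.

    Euler transformation.  Averaging the partial sums g_0 + ... + g_b against
    the binomial law with parameters M and 2/3 gives [euler_mean], and passing
    from M to M + 1 changes the average by exactly - a_(M+1) / 3^(M+1)
    ([sum_inner_sum]).  The partial sums approach G at speed O(1/b), so the
    averages converge to G ([euler_mean_dist]) and the a_m / 3^m sum to 1 - G.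

    Positivity.  Every a_m with m >= 1 is positive ([moment2_gt0]).  It is
    twice the integral over [0, 1] of x^2 (1 - 2x^2)^(m-1) (- ln x), whose
    integrand changes sign; integration by parts becomes a two-term recurrence
    linking it to the same integral without the logarithm, and an explicit
    lower bound for the latter, for even exponents, keeps the recurrence
    positive.  The terms of the final series are then sums of products of
    positive rationals.

    Power series.  Since 1/G^r = (1 - S)^(-r) with S = 1 - G, a number in
    [0, 1), the negative binomial series expands it in powers S^j, and expanding
    S^j as a product of j copies of the series of a_m / 3^m yields the sums over
    compositions.  As all terms are nonnegative, the rearrangement is a
    two-sided comparison with powers of the truncated polynomials
    ([composition_series_cvg]). *)

Set Implicit Arguments.
Unset Strict Implicit.
Unset Printing Implicit Defensive.

Local Open Scope classical_set_scope.
Local Open Scope ring_scope.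

(** * Positivity of the inner sums *)

(** For e = 1 and e = 2 this is the integral over [0, 1] of
    x^2 (1 - 2x^2)^N (- ln x)^(e-1), expanded by the binomial theorem. *)
Definition moment (F : fieldType) (e N : nat) : F :=
  \sum_(i < N.+1) 'C(N, i)%:R * (-2) ^+ i / (i.*2 + 3)%:R ^+ e.

Lemma moment0 (F : fieldType) N : moment F 0 N = (-1) ^+ N.
Proof.
transitivity ((1 + (-2)) ^+ N : F); last by congr (_ ^+ _); ring.
rewrite exprDn; apply: eq_bigr => i _.
by rewrite expr0 divr1 expr1n mul1r mulr_natl.
Qed.

(** The integration by parts of x^3 (1 - 2x^2)^(N+1), done on coefficients:
    by (N+1) 'C(N, i) = (N+1-i) 'C(N+1, i), the difference of the two integrals
    acquires the factor 2i + 3, which lowers e by one. *)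
Lemma momentS (F : numFieldType) e N :
  (2 * N + 5)%:R * moment F e.+1 N.+1 =
  (2 * N + 2)%:R * moment F e.+1 N + moment F e N.+1.
Proof.
have -> : moment F e.+1 N =
   \sum_(i < N.+2) 'C(N, i)%:R * (-2) ^+ i / (i.*2 + 3)%:R ^+ e.+1.
  by rewrite big_ord_recr /= bin_small // !mul0r addr0.
rewrite !mulr_sumr -big_split; apply: eq_bigr => i _ /=.
have le_iN : (i <= N.+1)%N by rewrite -ltnS.
have binE : (N.+1)%:R * 'C(N, i)%:R = (N.+1%:R - i%:R) * 'C(N.+1, i)%:R :> F.
  by rewrite -natrB // -!natrM -mul_bin_down.
have i3 : (i.*2 + 3)%:R != 0 :> F by rewrite pnatr_eq0 addnS.
have -> : (2 * N + 2)%:R = 2 * N.+1%:R :> F.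
  by rewrite -natrM; congr (_%:R); rewrite mulnS addnC.
rewrite -[2 * N.+1%:R * _]mulrA !(mulrA N.+1%:R) binE.
have -> : (2 * N + 5)%:R = 2 * (N.+1%:R - i%:R) + (i.*2 + 3)%:R :> F.
  by rewrite -mul2n !natrD -natr1; ring.
set u : F := (i.*2 + 3)%:R in i3 *; have ue : u ^+ e != 0 by rewrite expf_neq0.
by rewrite exprS; field; rewrite ue -natrD.
Qed.

Lemma moment_odd (F : numFieldType) e j :
  (4 * j%:R + 5) * moment F e.+1 j.*2.+1 =
  (4 * j%:R + 2) * moment F e.+1 j.*2 + moment F e j.*2.+1.
Proof.
have c k : 4 * j%:R + k%:R = (2 * j.*2 + k)%:R :> F.
  by rewrite natrD natrM -mul2n natrM; ring.
by rewrite (c 5) (c 2) -momentS.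
Qed.

Lemma moment_even (F : numFieldType) e j :
  (4 * j%:R + 7) * moment F e.+1 j.+1.*2 =
  (4 * j%:R + 4) * moment F e.+1 j.*2.+1 + moment F e j.+1.*2.
Proof.
have c k : (2 * j.*2.+1 + k)%:R = 4 * j%:R + 2 + k%:R :> F.
  by rewrite natrD natrM -[j.*2.+1%:R]natr1 -mul2n natrM; ring.
have -> : 4 * j%:R + 7 = 4 * j%:R + 2 + 5 :> F by ring.
have -> : 4 * j%:R + 4 = 4 * j%:R + 2 + 2 :> F by ring.
by rewrite -!c doubleS -momentS.
Qed.

(** The sequence [moment F 1] alternates in sign, behaving like
    (-1)^N / (4N) plus a positive term of order N^(-3/2); the bound is the main
    part 1 / (2(4j+3)) of an even term increased by the factor
    1 + 1 / (6j+3).  That surplus is large enough for [moment2_gt0] and small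
    enough to be reproduced by two steps of the recurrence. *)
Lemma moment1_even_ge (F : realFieldType) j :
  (3 * j%:R + 2) / (3 * (2 * j%:R + 1) * (4 * j%:R + 3)) <= moment F 1 j.*2.
Proof.
elim: j => [|j IHj].
  rewrite /moment double0 big_ord1 bin0 expr0 expr1 double0 add0n !mulr0 !add0r.
  by rewrite ler_pdivrMr; lra.
have := moment_even F 0 j; have := moment_odd F 0 j.
have -> : moment F 0 j.+1.*2 = 1 by rewrite moment0 -signr_odd odd_double.
have -> : moment F 0 j.*2.+1 = -1.
  by rewrite moment0 -signr_odd /= odd_double expr1.
have x0 : 0 <= j%:R :> F by [].
rewrite -[j.+1%:R]natr1.
set x : F := j%:R in x0 IHj *; set w := moment F 1 j.*2 in IHj *.
set w1 := moment F 1 j.*2.+1; set w2 := moment F 1 j.+1.*2 => e1 e2.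
have den_gt0 (y : F) : 0 <= y -> 0 < 3 * (2 * y + 1) * (4 * y + 3).
  by move=> y0; rewrite !mulr_gt0 //; lra.
rewrite ler_pdivrMr; last by apply: den_gt0; lra.
move: IHj; rewrite ler_pdivrMr ?den_gt0 // => IHj.
have p : 0 < (4 * x + 5) * (4 * x + 3) by rewrite mulr_gt0 //; lra.
(* Once e1 and e2 eliminate w1 and w2, the difference of both sides is a
   nonnegative multiple of the induction hypothesis plus x. *)
rewrite -(ler_pM2r p) -subr_ge0.
have -> : w2 * (3 * (2 * (x + 1) + 1) * (4 * (x + 1) + 3)) *
            ((4 * x + 5) * (4 * x + 3)) -
          (3 * (x + 1) + 2) * ((4 * x + 5) * (4 * x + 3)) =
  2 * (2 * x + 3) * (4 * x + 4) *
     (w * (3 * (2 * x + 1) * (4 * x + 3)) - (3 * x + 2)) + x.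
  transitivity (3 * (2 * x + 3) * ((4 * x + 5) * (4 * x + 3)) *
                  ((4 * x + 7) * w2) -
          (3 * (x + 1) + 2) * ((4 * x + 5) * (4 * x + 3))); first by ring.
  rewrite e2.
  transitivity (3 * (2 * x + 3) * (4 * x + 3) * (4 * x + 4) *
                  ((4 * x + 5) * w1)
     + 3 * (2 * x + 3) * ((4 * x + 5) * (4 * x + 3)) -
          (3 * (x + 1) + 2) * ((4 * x + 5) * (4 * x + 3))); first by ring.
  by rewrite e1; ring.
by rewrite addr_ge0 // mulr_ge0 ?subr_ge0 // !mulr_ge0 //; lra.
Qed.

(** The recurrence adds [moment F 1 N] to a positive multiple of the preceding
    value, and that summand is negative for odd N; grouping each odd step with
    the even step before it, the lower bound on the even one outweighs the
    loss. *)
Lemma moment2_gt0 (F : realFieldType) N : 0 < moment F 2 N.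
Proof.
(* The factor 4j makes the hypothesis hold for j = 0 whatever the meaning of
   the index 0 - 1. *)
have step j : 0 <= 4 * j%:R * moment F 2 j.*2.-1 ->
    0 < moment F 2 j.*2 /\ 0 < moment F 2 j.*2.+1.
  move=> prev_ge0.
  have x0 : 0 <= j%:R :> F by [].
  have ec : (4 * j%:R + 3) * moment F 2 j.*2 =
      4 * j%:R * moment F 2 j.*2.-1 + moment F 1 j.*2.
    case: j {prev_ge0 x0} => [|j].
      rewrite /moment double0 !big_ord1 !bin0 expr0 double0 add0n !mulr0.
      by field.
    rewrite -[j.+1%:R]natr1 (_ : j.+1.*2.-1 = j.*2.+1) //.
    rewrite (_ : 4 * (j%:R + 1) = 4 * j%:R + 4); last by ring.
    by rewrite -moment_even; ring.
  have := moment1_even_ge F j; have := moment_odd F 0 j.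
  have := moment_odd F 1 j.
  have -> : moment F 0 j.*2.+1 = -1.
    by rewrite moment0 -signr_odd /= odd_double expr1.
  set x : F := j%:R in x0 prev_ge0 ec *.
  set y := _ * moment F 2 j.*2.-1 in prev_ge0 ec.
  set c := moment F 2 j.*2 in ec *; set c1 := moment F 2 j.*2.+1.
  set d := moment F 1 j.*2 in ec *; set d1 := moment F 1 j.*2.+1.
  move=> ec1 ed1.
  have den_gt0 : 0 < 3 * (2 * x + 1) * (4 * x + 3) by rewrite !mulr_gt0 //; lra.
  move=> d_ge; have d0 : 0 < d.
    by apply: lt_le_trans d_ge; rewrite divr_gt0 //; lra.
  move: d_ge; rewrite ler_pdivrMr // => d_ge.
  have c0 : 0 < c by rewrite -(@pmulr_rgt0 _ (4 * x + 3)) ?ec; lra.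
  split=> //.
  have p : 0 < (4 * x + 5) ^+ 2 * (4 * x + 3) ^+ 2 * 3.
    by rewrite !mulr_gt0 ?exprn_gt0 //; lra.
  (* Clearing denominators splits c1 into the contribution of the previous
     pair, the surplus of d over its lower bound, and a positive rest. *)
  rewrite -(@pmulr_rgt0 _ _ c1 p).
  have -> : (4 * x + 5) ^+ 2 * (4 * x + 3) ^+ 2 * 3 * c1 =
     3 * (4 * x + 2) * (4 * x + 5) * (4 * x + 3) * y +
     (16 * x + 16) * (d * (3 * (2 * x + 1) * (4 * x + 3)) - (3 * x + 2)) +
     (8 * x + 5).
    transitivity ((4 * x + 5) * (4 * x + 3) ^+ 2 * 3 * ((4 * x + 5) * c1)).
      by ring.
    rewrite ec1.
    transitivity ((4 * x + 5) * (4 * x + 3) * 3 * (4 * x + 2) *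
                    ((4 * x + 3) * c)
      + (4 * x + 3) ^+ 2 * 3 * ((4 * x + 5) * d1)); first by ring.
    by rewrite ec ed1; ring.
  apply: ltr_wpDl; last by lra.
  rewrite addr_ge0 // mulr_ge0 ?subr_ge0 //; last by lra.
  by rewrite !mulr_ge0 //; lra.
have pair j : 0 < moment F 2 j.*2 /\ 0 < moment F 2 j.*2.+1.
  elim: j => [|j [_ IHj]]; apply: step; first by rewrite mulr0 mul0r.
  by rewrite doubleS /= mulr_ge0 ?mulr_ge0 // ltW.
rewrite -[N]odd_double_half; case: (odd N); first by case: (pair N./2).
by case: (pair N./2).
Qed.

(** * The Euler transformation *)

(** The expectation of [u b] when b counts the successes in M independent
    trials of success probability 2/3. *)
Definition euler_mean (F : fieldType) (u : nat -> F) (M : nat) : F :=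
  (\sum_(b < M.+1) 'C(M, b)%:R * (2 ^+ b * u b)) / 3 ^+ M.

Lemma sum_binS (R : comPzRingType) (f : nat -> R) M :
  \sum_(b < M.+2) 'C(M.+1, b)%:R * f b =
  \sum_(b < M.+1) 'C(M, b)%:R * (f b + f b.+1).
Proof.
under [RHS]eq_bigr do rewrite mulrDr.
rewrite big_split /= big_ord_recl /= !bin0.
under eq_bigr => b _ do rewrite /bump /= add1n binS natrD mulrDl.
rewrite big_split /= addrA; congr (_ + _).
rewrite big_ord_recr /= bin_small // mul0r addr0.
by rewrite [RHS]big_ord_recl /= bin0.
Qed.

(** One further trial replaces b by b + 1 with probability 2/3, so the mean
    changes by 2/3 of the mean increment of u. *)
Lemma euler_meanS (F : numFieldType) (u : nat -> F) M :
  euler_mean u M.+1 - euler_mean u M =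
  (\sum_(b < M.+1) 'C(M, b)%:R * (2 ^+ b.+1 * (u b.+1 - u b))) / 3 ^+ M.+1.
Proof.
rewrite /euler_mean (sum_binS (fun b => 2 ^+ b * u b)).
have -> (x : F) : x / 3 ^+ M = 3 * x / 3 ^+ M.+1.
  by rewrite exprS; field; rewrite expf_neq0 ?pnatr_eq0.
rewrite -mulrBl; congr (_ / _).
rewrite mulr_sumr -sumrB; apply: eq_bigr => b _.
by rewrite exprS; ring.
Qed.

(** The expectation of 1 / (b+1) is explicit: 'C(M, b) / (b+1) is
    'C(M+1, b+1) / (M+1), and the resulting sum is part of a binomial
    expansion of 3^(M+1). *)
Lemma euler_mean_dist (F : realFieldType) (u : nat -> F) (l C : F) M :
  (forall b, `|u b - l| <= C / b.+1%:R) ->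
  `|euler_mean u M - l| <= 3 / 2 * C / M.+1%:R.
Proof.
move=> u_l.
have sum3 n : \sum_(b < n.+1) 'C(n, b)%:R * 2 ^+ b = 3 ^+ n :> F.
  transitivity ((1 + 2) ^+ n : F); last by congr (_ ^+ _); ring.
  by rewrite exprDn; apply: eq_bigr => b _; rewrite expr1n mul1r mulr_natl.
have p3 n : 0 < 3 ^+ n :> F by rewrite exprn_gt0.
have -> : euler_mean u M - l =
    (\sum_(b < M.+1) 'C(M, b)%:R * (2 ^+ b * (u b - l))) / 3 ^+ M.
  rewrite -[l in LHS](mulfK (lt0r_neq0 (p3 M))) -mulrBl; congr (_ / _).
  rewrite -{1}sum3 mulr_sumr -sumrB; apply: eq_bigr => b _; ring.
have C0 : 0 <= C by have := le_trans (normr_ge0 _) (u_l 0%N); rewrite divr1.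
rewrite normrM normfV (gtr0_norm (p3 M)) ler_pdivrMr //.
apply: le_trans (ler_norm_sum _ _ _) _.
apply: (@le_trans _ _ (\sum_(b < M.+1)
     C / (2 * M.+1%:R) * ('C(M.+1, b.+1)%:R * 2 ^+ b.+1))).
  apply: ler_sum => b _; rewrite !normrM normrX !normr_nat.
  have /(congr1 (fun n => n%:R : F)) := mul_bin_diag M.+1 b.
  rewrite /= !natrM => e.
  have -> : 'C(M.+1, b.+1)%:R = M.+1%:R / b.+1%:R * 'C(M, b)%:R :> F.
    by rewrite mulrAC e mulrAC mulfV ?mul1r // pnatr_eq0.
  have -> : C / (2 * M.+1%:R) *
      (M.+1%:R / b.+1%:R * 'C(M, b)%:R * 2 ^+ b.+1) =
      'C(M, b)%:R * (2 ^+ b * (C / b.+1%:R)).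
    by rewrite exprS; field; rewrite !nat1r !pnatr_eq0.
  by rewrite !ler_wpM2l ?exprn_ge0.
rewrite -mulr_sumr.
have -> : 3 / 2 * C / M.+1%:R * 3 ^+ M = C / (2 * M.+1%:R) * 3 ^+ M.+1.
  by rewrite exprS; field; rewrite nat1r pnatr_eq0.
apply: ler_wpM2l; first by rewrite divr_ge0 // mulr_ge0.
rewrite -sum3 [leRHS]big_ord_recl /= lerDr.
by rewrite bin0 mul1r.
Qed.

(** * Convergence to Catalan's constant *)

Definition catalan_term (R : realType) (k : nat) : R :=
  (-1) ^+ k / (k.*2.+1)%:R ^+ 2.

(** 1 / (2k+1)^2 is at most 1 / (4k(k+1)), which telescopes. *)
Lemma catalan_tail (R : realType) (m n : nat) :
  `|series (catalan_term R) (n.+1 + m)%N - series (catalan_term R) n.+1| <=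
    4^-1 * (n.+1%:R^-1 - (n.+1 + m)%:R^-1).
Proof.
elim: m => [|m IHm]; first by rewrite addn0 !subrr mulr0 normr0.
rewrite addnS seriesSr addrAC (le_trans (ler_normD _ _)) //.
apply: le_trans (lerD IHm (lexx _)) _.
rewrite -lerBrDl -mulrBr.
rewrite normrM normfV !normrX normrN1 expr1n mul1r normr_nat.
rewrite addSn; set k := (n + m)%N.
have x0 : 0 <= k%:R :> R by [].
have k1 : 0 < k.+1%:R :> R by [].
have -> : (k.+1.*2.+1)%:R = 2 * k.+1%:R + 1 :> R.
  by rewrite -natr1 -muln2 natrM mulrC.
rewrite -[k.+2%:R]natr1; set x : R := k.+1%:R in k1 *; set z : R := n.+1%:R^-1.
have -> : z - (x + 1)^-1 - (z - x^-1) =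
    (x * (x + 1))^-1 :> R by field; rewrite !gt_eqF //; lra.
rewrite -invfM lef_pV2 ?posrE ?exprn_gt0 ?mulr_gt0 //; nra.
Qed.

(** [catalan_constant] is a [limn], hence meaningless without convergence; the
    series converges absolutely, its normed partial sums being bounded by
    2 - 1 / (n+1). *)
Lemma catalan_series_cvg (R : realType) :
  series (catalan_term R) @ \oo --> catalan_constant R.
Proof.
suff : cvgn (series (catalan_term R)) by [].
apply: normed_cvg; rewrite /normed_series_of; apply: nondecreasing_is_cvgn.
  by apply: nondecreasing_series => n _ _ /=; exact: normr_ge0.
exists 2 => _ [[|n] _ <-]; first by rewrite /series /= big_nil.
set v : nat -> R := fun n => `|catalan_term R n|.
suff : series v n.+1 <= 2 - n.+1%:R^-1.
  by move/le_trans; apply; rewrite lerBlDr lerDl invr_ge0.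
elim: n => [|n IHn].
  rewrite /series /= big_nat1 /v /catalan_term expr0 expr1n.
  by rewrite divr1 normr1 invr1; lra.
rewrite seriesSr (le_trans (lerD IHn (lexx _))) //=.
have := catalan_tail R 1 n; rewrite addn1 seriesSB.
have : n.+2%:R^-1 <= n.+1%:R^-1 :> R by rewrite lef_pV2 ?posrE // ler_nat.
rewrite /v; move: (n.+2%:R^-1) (n.+1%:R^-1) `|_| => a b c.
lra.
Qed.

Lemma catalan_dist (R : realType) (n : nat) :
  `|series (catalan_term R) n.+1 - catalan_constant R| <= 4^-1 / n.+1%:R.
Proof.
have h m : (n.+1 <= m)%N ->
    `|series (catalan_term R) m - series (catalan_term R) n.+1| <=
     4^-1 / n.+1%:R.
  move=> /subnKC <-; apply: le_trans (catalan_tail _ _ _) _.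
  by apply: ler_wpM2l; rewrite ?gerBl ?invr_ge0.
rewrite distrC.
have c := @catalan_series_cvg R; have cc : cvgn (series (catalan_term R)) by [].
rewrite ler_distl; apply/andP; split.
  apply: limr_ge => //; near=> m.
  have := h m; rewrite ler_distl => /(_ _)/andP[]//.
  by near: m; exact: nbhs_infty_ge.
apply: limr_le => //; near=> m.
have := h m; rewrite ler_distl => /(_ _)/andP[]//.
by near: m; exact: nbhs_infty_ge.
Unshelve. all: by end_near. Qed.

Lemma catalan_gt0 (R : realType) : 0 < catalan_constant R.
Proof.
have := catalan_dist R 0; rewrite /series /= big_nat1 /catalan_term expr0.
by rewrite expr1n !divr1 ler_distl => /andP[_]; lra.
Qed.

Lemma inner_sumS (R : realType) N : inner_sum R N.+1 = 2 * moment R 2 N.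
Proof.
rewrite /inner_sum /moment big_add1 big_mkord mulr_sumr; apply: eq_bigr => i _.
rewrite /= doubleS addn3 [(-2) ^+ _]exprNn !exprS expr0.
move: (_ %:R * _)^-1 => d. ring.
Qed.

(** Each term of the left-hand sum is minus one increment of the Euler means,
    and the mean for M = 0 is the first partial sum, which is 1. *)
Lemma sum_inner_sum (R : realType) M :
  \sum_(m < M.+1) inner_sum R m / 3 ^+ m =
  1 - euler_mean (fun b => series (catalan_term R) b.+1) M.
Proof.
elim: M => [|M IHM].
  rewrite big_ord1 /inner_sum big_geq // mul0r /euler_mean big_ord1 bin0 !expr0.
  rewrite /series /= big_nat1 /catalan_term expr0 expr1n.
  by field.
rewrite big_ord_recr /= IHM.
have := euler_meanS (fun b => series (catalan_term R) b.+1) M.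
have -> : \sum_(b < M.+1) 'C(M, b)%:R * (2 ^+ b.+1 *
    (series (catalan_term R) b.+2 - series (catalan_term R) b.+1)) =
    - inner_sum R M.+1.
  rewrite inner_sumS /moment mulr_sumr -sumrN; apply: eq_bigr => b _.
  rewrite seriesSB /catalan_term doubleS addn3 [(-2) ^+ _]exprNn !exprS.
  by move: (_ %:R * _)^-1 => d; ring.
by rewrite mulNr => /eqP; rewrite subr_eq => /eqP ->; ring.
Qed.

(** * Composition sums as coefficients of powers *)

Definition trunc (R : nzRingType) (u : nat -> R) (N : nat) : {poly R} :=
  \poly_(m < N.+1) u m.

Lemma eq_coef_exp (R : nzRingType) (p q : {poly R}) n j :
  (forall i, (i <= n)%N -> p`_i = q`_i) -> (p ^+ j)`_n = (q ^+ j)`_n.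
Proof.
move=> pq; suff H i : (i <= n)%N -> (p ^+ j)`_i = (q ^+ j)`_i by exact: H.
elim: j i => [|j IHj] i le_in; first by rewrite !expr0.
rewrite !exprS !coefM; apply: eq_bigr => k _.
have k_le : (k <= i)%N by rewrite -ltnS.
rewrite pq ?(leq_trans k_le) // IHj //.
exact: leq_trans (leq_subr _ _) le_in.
Qed.

Lemma le_coef_exp (R : numDomainType) (p q : {poly R}) j n :
  (forall i, 0 <= p`_i <= q`_i) -> 0 <= (p ^+ j)`_n <= (q ^+ j)`_n.
Proof.
move=> pq; elim: j n => [|j IHj] n.
  by rewrite !expr0 coef1 lexx andbT; case: (n == 0%N).
rewrite !exprS !coefM; apply/andP; split.
  apply: sumr_ge0 => k _; apply: mulr_ge0.
    by case/andP: (pq k).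
  by case/andP: (IHj (n - k)%N).
apply: ler_sum => k _; case/andP: (pq k) => ? ?.
case/andP: (IHj (n - k)%N) => ? ?.
exact: ler_pM.
Qed.

(** Distributing the j-th power of a polynomial produces one monomial for each
    j-tuple of exponents.  Coefficients of order at most n see only the first
    n + 1 coefficients of u, which accounts for the freedom in N; tuples with a
    part equal to 0 vanish because [u 0 = 0]. *)
Lemma coef_trunc_exp (R : comNzRingType) (u : nat -> R) n N j :
  u 0%N = 0 -> (n <= N)%N ->
  (trunc u N ^+ j)`_n =
  \sum_(p in compositions n j) \prod_(l < j) u (p l).
Proof.
move=> u0 le_nN.
have -> : (trunc u N ^+ j)`_n = (trunc u n ^+ j)`_n.
  apply: eq_coef_exp => i le_in.
  by rewrite !coef_poly !ltnS le_in (leq_trans le_in).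
rewrite /trunc poly_def -[j in LHS]card_ord -prodr_const bigA_distr_bigA /=.
rewrite coef_sum [RHS]big_mkcond; apply: eq_bigr => p _.
rewrite scaler_prod -expr_sum coefZ coefXn inE eq_sym.
have [_|_] := eqVneq; last by rewrite andbF mulr0.
rewrite andbT mulr1; case: forallP => // /forallP.
rewrite negb_forall => /existsP[l]; rewrite -eqn0Ngt => /eqP pl0.
by rewrite (bigD1 l) //= pl0 u0 mul0r.
Qed.

Lemma compositions_empty n j (p : {ffun 'I_j -> 'I_n.+1}) :
  (n < j)%N -> (p \in compositions n j) = false.
Proof.
move=> lt_nj; rewrite inE; apply/negP => /andP[/forallP p1 /eqP e].
move: lt_nj; rewrite ltnNge -e => /negP; apply.
rewrite -[leqLHS]muln1 -[j in leqLHS]card_ord -sum_nat_const.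
by apply: leq_sum => l _; exact: p1.
Qed.

(** * The negative binomial series *)

Definition negbin_sum (R : pzRingType) (r J : nat) (x : R) : R :=
  \sum_(0 <= j < J) 'C(r + j - 1, j)%:R * x ^+ j.

(** Pascal's rule: up to a boundary term, multiplying by 1 - x takes first
    differences of the coefficients in j, which lowers r by one. *)
Lemma negbin_sum_rec (R : comPzRingType) r J (x : R) :
  (1 - x) * negbin_sum r.+1 J.+1 x =
  negbin_sum r J.+1 x - 'C(r + J, J)%:R * x ^+ J.+1.
Proof.
elim: J => [|J IHJ].
  by rewrite /negbin_sum !big_nat1 !addn0 !bin0 !expr0 expr1; ring.
rewrite /negbin_sum big_nat_recr //= mulrDr IHJ [in RHS]big_nat_recr //=.
rewrite -/(negbin_sum r J.+1 x) addSn addnS !subn1 /= binS natrD !exprS; ring.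
Qed.

Lemma negbin_sum_nondecreasing (R : realDomainType) r (x : R) : 0 <= x ->
  nondecreasing_seq (negbin_sum r ^~ x).
Proof.
move=> x0; apply/nondecreasing_seqP => J.
by rewrite /negbin_sum big_nat_recr //= lerDl mulr_ge0 ?exprn_ge0.
Qed.

(** Induction on r through [negbin_sum_rec].  Convergence has to come first, by
    monotonicity and the bound from the previous r, since only then does the
    boundary term, a general term of a convergent series times x, tend to 0. *)
Lemma negbin_sum_cvg (R : realType) r (x : R) : 0 <= x < 1 ->
  negbin_sum r ^~ x @ \oo --> (1 - x) ^- r.
Proof.
case/andP=> x0 x1; have y0 : 0 < 1 - x by rewrite subr_gt0.
elim: r => [|r IHr].
  (* For r = 0 only the j = 0 coefficient survives, with 'C(0 - 1, 0) = 1. *)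
  rewrite expr0 invr1 -cvg_shiftS; apply: cvg_near_cst; apply: nearW => J /=.
  rewrite /negbin_sum big_nat_recl // big1 ?addr0 ?expr0 ?mulr1 //.
  by move=> j _; rewrite add0n subn1 /= bin_small // mul0r.
have cv : cvgn (negbin_sum r.+1 ^~ x).
  apply: nondecreasing_is_cvgn; first exact: negbin_sum_nondecreasing.
  exists ((1 - x)^-1 * (1 - x) ^- r) => _ [J _ <-].
  rewrite mulrC ler_pdivlMr // mulrC.
  apply: (@le_trans _ _ ((1 - x) * negbin_sum r.+1 J.+1 x)).
    by rewrite ler_pM2l //; apply: negbin_sum_nondecreasing.
  rewrite negbin_sum_rec; apply: (@le_trans _ _ (negbin_sum r J.+1 x)).
    by rewrite gerBl mulr_ge0 // exprn_ge0.
  rewrite -(cvg_lim _ IHr) //.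
  apply: nondecreasing_cvgn_le; last by apply: cvgP IHr.
  exact: negbin_sum_nondecreasing.
have term0 : 'C(r + J, J)%:R * x ^+ J.+1 @[J --> \oo] --> 0.
  have cv' : cvgn (series (fun j => 'C(r.+1 + j - 1, j)%:R * x ^+ j)) by [].
  have -> : (fun J => 'C(r + J, J)%:R * x ^+ J.+1) =
      (fun J => 'C(r.+1 + J - 1, J)%:R * x ^+ J * x).
    by apply/funext => J; rewrite addSn subn1 exprSr mulrA.
  rewrite -[X in _ --> X](mul0r x); apply: cvgMr_tmp.
  exact: cvg_series_cvg_0 cv'.
rewrite exprS invfM.
rewrite -cvg_shiftS /=.
have -> : (fun J => negbin_sum r.+1 J.+1 x) =
    (fun J => (1 - x)^-1 *
      (negbin_sum r J.+1 x - 'C(r + J, J)%:R * x ^+ J.+1)).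
  apply/funext => J.
  by rewrite -negbin_sum_rec mulKf // gt_eqF.
apply: cvgMl_tmp; rewrite -[X in _ --> X]subr0; apply: cvgB => //.
by rewrite (cvg_shiftS (negbin_sum r ^~ x)).
Qed.

(** * Powers of a nonnegative series of sum less than one *)

Section CompositionSeries.
Variables (R : realType) (u : nat -> R) (r : nat) (S : R).
Hypotheses (u0 : u 0%N = 0) (u_ge0 : forall m, 0 <= u m).
Hypothesis u_sum : (fun N : nat => \sum_(m < N.+1) u m) @ \oo --> S.
Hypothesis S_lt1 : S < 1.

Definition composition_term n : R :=
  \sum_(1 <= j < n.+1) 'C(r + j - 1, j)%:R *
     \sum_(p in compositions n j) \prod_(l < j) u (p l).

Let psum N := \sum_(1 <= n < N.+1) composition_term n.

Let trunc1 N : (trunc u N).[1] = \sum_(m < N.+1) u m.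
Proof. by rewrite horner_poly; apply: eq_bigr => m _; rewrite expr1n mulr1. Qed.

Let trunc1_le N : (trunc u N).[1] <= S.
Proof.
rewrite trunc1 -(cvg_lim _ u_sum) //.
apply: (@nondecreasing_cvgn_le _ (fun N : nat => \sum_(m < N.+1) u m));
  last exact: cvgP u_sum.
by apply/nondecreasing_seqP => n; rewrite [leRHS]big_ord_recr lerDl.
Qed.

Let trunc1_ge0 N : 0 <= (trunc u N).[1].
Proof. by rewrite trunc1 sumr_ge0. Qed.

Let coef_ge0 N j n : 0 <= (trunc u N ^+ j)`_n.
Proof.
suff /(le_coef_exp j n)/andP[] :
  forall i, 0 <= (trunc u N)`_i <= (trunc u N)`_i by [].
by move=> i; rewrite lexx andbT coef_poly; case: ifP.
Qed.

(* A positive integer n has no composition into more than n parts, so j may run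
   up to N; the coefficient of order 0 vanishes for j >= 1, so n may start
   at 0. *)
Let psumE N : psum N = \sum_(1 <= j < N.+1) 'C(r + j - 1, j)%:R *
   \sum_(n < N.+1) (trunc u N ^+ j)`_n.
Proof.
rewrite /psum /composition_term.
transitivity (\sum_(1 <= n < N.+1) \sum_(1 <= j < N.+1)
    'C(r + j - 1, j)%:R * (trunc u N ^+ j)`_n).
  apply: eq_big_nat => n /andP[n1 nN].
  rewrite [RHS](@big_cat_nat _ _ _ n.+1) //=.
  rewrite [X in _ = _ + X]big_nat [X in _ = _ + X]big1 ?addr0.
    by apply: eq_bigr => j _; rewrite (coef_trunc_exp _ u0).
  move=> j /andP[nj _]; rewrite (coef_trunc_exp _ u0) //.
  by rewrite big_pred0 ?mulr0 // => p; rewrite compositions_empty.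
rewrite exchange_big; apply: eq_big_nat => j /andP[j1 _] /=.
rewrite -mulr_sumr; congr (_ * _).
rewrite big_add1 big_mkord [RHS]big_ord_recl /=.
rewrite -horner_coef0 horner_exp horner_coef0.
by rewrite coef_poly u0 expr0n gtn_eqF // add0r.
Qed.

(* The coefficients of order at most N of a nonnegative polynomial sum to at
   most its value at 1. *)
Let psum_le N : psum N <= (1 - S) ^- r - 1.
Proof.
have S0 : 0 <= S := le_trans (trunc1_ge0 0) (trunc1_le 0).
have S01 : 0 <= S < 1 by rewrite S0.
have cv := @negbin_sum_cvg _ r _ S01.
apply: (@le_trans _ _ (negbin_sum r N.+1 S - 1)); last first.
  rewrite lerB // -(cvg_lim _ cv) //.
  apply: nondecreasing_cvgn_le; last exact: cvgP cv.
  exact: negbin_sum_nondecreasing.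
rewrite psumE /negbin_sum [in leRHS]big_ltn // addn0 bin0 expr0 mulr1.
rewrite addrAC subrr add0r.
apply: ler_sum => j _; rewrite ler_wpM2l //.
apply: (@le_trans _ _ ((trunc u N).[1] ^+ j)); last first.
  by rewrite lerXn2r ?nnegrE.
rewrite -horner_exp.
rewrite (@horner_coef_wide _ (N.+1 + size (trunc u N ^+ j))) ?leq_addl //.
rewrite big_split_ord /= -[leLHS]addr0 lerD //.
  by apply: ler_sum => i _; rewrite expr1n mulr1.
by apply: sumr_ge0 => i _; rewrite expr1n mulr1.
Qed.

(* For j at most J, the j-th power of the truncation at K has degree at most
   J K, so its value at 1 is already reached by the coefficients of order at
   most N; replacing K by N only increases these. *)
Let psum_ge J K N : (J * K.+1 <= N)%N ->
  negbin_sum r J.+1 (trunc u K).[1] - 1 <= psum N.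
Proof.
move=> JKN; have KN : (0 < J)%N -> (K <= N)%N.
  move=> J0; rewrite (leq_trans _ JKN) // (leq_trans (leqnSn K)) //.
  by rewrite leq_pmull.
have JN : (J <= N)%N by rewrite (leq_trans _ JKN) // leq_pmulr.
rewrite psumE /negbin_sum [in leLHS]big_ltn // addn0 bin0 expr0 mulr1.
rewrite addrAC subrr add0r.
rewrite [leRHS](@big_cat_nat _ _ _ J.+1) //= -[leLHS]addr0 lerD //; last first.
  by apply: sumr_ge0 => j _; rewrite mulr_ge0 // sumr_ge0.
rewrite big_nat [leRHS]big_nat; apply: ler_sum => j /andP[j1 jJ].
rewrite ler_wpM2l // -horner_exp (@horner_coef_wide _ N.+1); last first.
  rewrite (leq_trans (size_poly_exp_leq _ _)) // ltnS (leq_trans _ JKN) //.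
  rewrite mulnC leq_mul // -subn1 leq_subLR add1n.
  by apply: leqW; apply: size_poly.
apply: ler_sum => n _; rewrite expr1n mulr1.
suff /(le_coef_exp j n)/andP[] :
  forall i, 0 <= (trunc u K)`_i <= (trunc u N)`_i by [].
move=> i; rewrite !coef_poly; case: ltnP => [iK|_].
  by rewrite (leq_trans iK) ?lexx ?u_ge0 // ltnS KN // (leq_trans j1).
by rewrite lexx /=; case: ifP.
Qed.

(** The partial sums increase and stay below (1 - S)^(-r) - 1 by [psum_le].
    Conversely their limit dominates, by [psum_ge], the negative binomial
    partial sum at every truncated value of S; letting the truncation, then the
    length J of that sum, tend to infinity gives the other inequality. *)
Lemma composition_series_cvg : psum @ \oo --> (1 - S) ^- r - 1.
Proof.
have term_ge0 n : 0 <= composition_term n.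
  apply: sumr_ge0 => j _; rewrite mulr_ge0 //; apply: sumr_ge0 => p _.
  by apply: prodr_ge0 => l _.
have nd : nondecreasing_seq psum.
  by apply/nondecreasing_seqP => N; rewrite /psum [leRHS]big_nat_recr //= lerDl.
have cv : cvgn psum.
  apply: nondecreasing_is_cvgn => //.
  by exists ((1 - S) ^- r - 1) => _ [N _ <-].
suff <- : limn psum = (1 - S) ^- r - 1 by [].
apply/eqP; rewrite eq_le; apply/andP; split.
  by apply: limr_le => //; apply: nearW.
have S0 : 0 <= S := le_trans (trunc1_ge0 0) (trunc1_le 0).
have S01 : 0 <= S < 1 by rewrite S0.
rewrite lerBlDr.
apply: (@cvgr_to_le nat \oo _ R (fun J => negbin_sum r J.+1 S)).
  by rewrite (cvg_shiftS (negbin_sum r ^~ S)); exact: negbin_sum_cvg.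
apply: nearW => J.
have negbinE x : negbin_sum r J.+1 x =
    (\poly_(j < J.+1) 'C(r + j - 1, j)%:R).[x].
  by rewrite horner_poly /negbin_sum big_mkord.
rewrite negbinE.
apply: (@cvgr_to_le nat \oo _ R (fun K =>
    (\poly_(j < J.+1) 'C(r + j - 1, j)%:R).[(trunc u K).[1]])).
  apply: (@cvg_comp _ _ _ (fun K => (trunc u K).[1]) (horner _) _ (nbhs S)).
    by under eq_fun do rewrite trunc1.
  exact: continuous_horner.
apply: nearW => K; rewrite -negbinE -lerBlDr.
apply: le_trans (psum_ge (leqnn _)) _.
exact: nondecreasing_cvgn_le.
Qed.

End CompositionSeries.

(** * The series for the inverse powers of Catalan's constant *)

Lemma inner_sum0 (R : realType) : inner_sum R 0 = 0.
Proof. by rewrite /inner_sum big_geq. Qed.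

Lemma inner_sum_gt0 (R : realType) n : (0 < n)%N -> 0 < inner_sum R n.
Proof. by case: n => // n _; rewrite inner_sumS mulr_gt0 // moment2_gt0. Qed.

Lemma sum_inner_sum_cvg (R : realType) :
  (fun M : nat => \sum_(m < M.+1) inner_sum R m / 3 ^+ m) @ \oo -->
    1 - catalan_constant R.
Proof.
apply/cvgrPdist_le => e e0.
have : 3 / 2 * 4^-1 * harmonic M @[M --> \oo] --> 3 / 2 * 4^-1 * (0 : R).
  by apply: cvgMl_tmp; exact: cvg_harmonic.
rewrite mulr0 => /cvgrPdist_le /(_ _ e0); apply: filterS => M.
rewrite sub0r normrN => /(le_trans (ler_norm _)); apply: le_trans.
rewrite sum_inner_sum distrC opprB addrC addrA addrNK distrC.
exact: euler_mean_dist (@catalan_dist R).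
Qed.

(** The factor 1 / 3^n is distributed over the parts of each composition. *)
Lemma series_termE (R : realType) r n :
  series_term R r n = composition_term (fun m => inner_sum R m / 3 ^+ m) r n.
Proof.
rewrite /series_term mulr_sumr; apply: eq_bigr => j _.
rewrite mulrCA; congr (_ * _); rewrite mulr_sumr; apply: eq_bigr => p.
rewrite inE => /andP[_ /eqP sum_p].
rewrite big_split /= mulrC prodfV; congr (_ * _^-1).
by rewrite -expr_sum sum_p.
Qed.

Section Rational.
Variable R : realType.
Implicit Types x y : R.

Lemma rational_nat n : rational (n%:R : R).
Proof. by exists n%:R => //; rewrite ratr_nat. Qed.

Lemma rationalD x y : rational x -> rational y -> rational (x + y).
Proof. by move=> [p _ <-] [q _ <-]; exists (p + q) => //; rewrite rmorphD. Qed.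

Lemma rationalM x y : rational x -> rational y -> rational (x * y).
Proof. by move=> [p _ <-] [q _ <-]; exists (p * q) => //; rewrite rmorphM. Qed.

Lemma rationalN x : rational x -> rational (- x).
Proof. by move=> [p _ <-]; exists (- p) => //; rewrite rmorphN. Qed.

Lemma rationalV x : rational x -> rational x^-1.
Proof. by move=> [p _ <-]; exists p^-1 => //; rewrite fmorphV. Qed.

Lemma rationalX x n : rational x -> rational (x ^+ n).
Proof. by move=> [p _ <-]; exists (p ^+ n) => //; rewrite rmorphXn. Qed.

Lemma rational_sum I (s : seq I) (P : pred I) (f : I -> R) :
  (forall i, P i -> rational (f i)) -> rational (\sum_(i <- s | P i) f i).
Proof.
by move=> ?; apply: big_ind => //; [exact: rational_nat 0|exact: rationalD].
Qed.

Lemma rational_prod I (s : seq I) (P : pred I) (f : I -> R) :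
  (forall i, P i -> rational (f i)) -> rational (\prod_(i <- s | P i) f i).
Proof.
by move=> ?; apply: big_ind => //; [exact: rational_nat 1|exact: rationalM].
Qed.

Lemma rational_inner_sum n : rational (inner_sum R n).
Proof.
apply: rational_sum => k _.
apply: rationalM; last exact: rational_nat.
apply: rationalM; last by apply/rationalV/rationalX/rational_nat.
apply: rationalM; apply: rationalX; last exact: rational_nat.
exact/rationalN/(rational_nat 1).
Qed.

Lemma rational_series_term r n : rational (series_term R r n).
Proof.
apply: rationalM; first by apply/rationalV/rationalX/rational_nat.
apply: rational_sum => j _; apply: rationalM; first exact: rational_nat.
apply: rational_sum => p _; apply: rational_prod => l _.
exact: rational_inner_sum.
Qed.

End Rational.

(** All summands are nonnegative, and j = 1 contributes the composition of n
    into the single part n. *)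
Lemma series_term_gt0 (R : realType) r n :
  (0 < r)%N -> (0 < n)%N -> 0 < series_term R r n.
Proof.
move=> r0 n0; rewrite mulr_gt0 ?invr_gt0 ?exprn_gt0 //.
have prod_ge0 j (p : {ffun 'I_j -> 'I_n.+1}) :
    p \in compositions n j -> 0 < \prod_(l < j) inner_sum R (p l).
  rewrite inE => /andP[/forallP p1 _]; apply: prodr_gt0 => l _.
  exact: inner_sum_gt0 (p1 l).
rewrite big_ltn // ltr_wpDr //.
  by apply: sumr_ge0 => j _; rewrite mulr_ge0 // sumr_ge0 // => p /prod_ge0/ltW.
rewrite mulr_gt0 //; first by rewrite ltr0n addnK bin1.
have p_in : [ffun=> ord_max] \in compositions n 1.
  rewrite inE big_ord1 ffunE eqxx andbT; apply/forallP => l.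
  by rewrite ffunE.
rewrite (bigD1 _ p_in) /= ltr_wpDr ?prod_ge0 //.
by apply: sumr_ge0 => p /andP[/prod_ge0/ltW].
Qed.

Theorem corollary5p2 (R : realType) (r : nat) (hr : (1 <= r)%N) :
  [/\ cvgn (fun N : nat => \sum_(1 <= n < N) series_term R r n),
      1 / catalan_constant R ^+ r =
        1 + limn (fun N : nat => \sum_(1 <= n < N) series_term R r n)
    & forall n : nat, (1 <= n)%N ->
        0 < series_term R r n /\ rational (series_term R r n)].
Proof.
have sum_cvg : (fun N : nat => \sum_(1 <= n < N) series_term R r n) @ \oo -->
    catalan_constant R ^- r - 1.
  rewrite -cvg_shiftS.
  rewrite -[catalan_constant R in X in _ --> X](subKr 1).
  under eq_fun do under eq_bigr do rewrite series_termE.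
  apply: composition_series_cvg.
  - by rewrite inner_sum0 mul0r.
  - case=> [|m]; first by rewrite inner_sum0 mul0r.
    by rewrite divr_ge0 ?exprn_ge0 // ltW // inner_sum_gt0.
  - exact: sum_inner_sum_cvg.
  - by rewrite gtrBl catalan_gt0.
split; first exact: cvgP sum_cvg.
  by rewrite (cvg_lim _ sum_cvg) // addrC subrK div1r.
by move=> n n1; split; [exact: series_term_gt0|exact: rational_series_term].
Qed.
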